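(* Let $\phi,\psi$ be modal formulas such that $\phi\to\psi$ is valid, and fix a type elimination sequence $\mathcal X_0,\dots,\mathcal X_n$ for $\phi,\psi$ whose final quasi-model $\mathcal X_n$ contains no type $\tau$ with $\mathrm{nnf}(\phi)\in\tau_L$ and $\mathrm{nnf}(\neg\psi)\in\tau_R$. If a type $\tau=(\tau_L,\tau_R)$ gets eliminated in this sequence (i.e. $\tau\in\mathcal X_0\setminus\mathcal X_n$), then there is a modal formula $\vartheta_\tau$ such that $\models(\bigwedge\tau_L)\to\vartheta_\tau$, $\models\vartheta_\tau\to\neg(\bigwedge\tau_R)$, and every proposition letter occurring positively (resp. negatively) in $\vartheta_\tau$ occurs positively (resp. negatively) in both $\phi$ and $\psi$.
   Context: Validity $\models$ is truth at all worlds of all Kripke models. $\mathrm{nnf}(\chi)$ is the negation normal form of $\chi$. For $\chi$ in NNF, $\mathrm{SUBF}(\chi)$ is its set of subformulas, except $\mathrm{SUBF}(\neg p)=\{\neg p\}$. $X\subseteq\mathrm{SUBF}(\chi)$ is locally consistent if conjunctions in $X$ have both conjuncts in $X$, disjunctions in $X$ have a disjunct in $X$, $\bot\notin X$, and no $p,\neg p$ both in $X$. L-types are locally consistent subsets of $\mathrm{SUBF}(\mathrm{nnf}(\phi))$, R-types of $\mathrm{SUBF}(\mathrm{nnf}(\neg\psi))$; a type is a pair $(\tau_L,\tau_R)$. A type is overlap-consistent if no letter $p$ has $p$ in one component and $\neg p$ in the other. $\tau\Rightarrow\tau'$ means for $D\in\{L,R\}$, $\Box\chi\in\tau_D$ implies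 $\chi\in\tau'_D$. A quasi-model is a set $\mathcal X$ of types whose members are overlap-consistent and such that for every $\tau\in\mathcal X$, $D\in\{L,R\}$, $\Diamond\chi\in\tau_D$ there is $\tau'\in\mathcal X$ with $\tau\Rightarrow\tau'$ and $\chi\in\tau'_D$. A type elimination sequence is $\mathcal X_0,\dots,\mathcal X_n$ with $\mathcal X_0$ the set of all types, each $\mathcal X_{i+1}$ obtained from $\mathcal X_i$ by removing one type violating one of the two quasi-model conditions relative to $\mathcal X_i$, and $\mathcal X_n$ a quasi-model. Positive/negative occurrences of letters are defined as usual. *)

(* Defs.v *)
From HB Require Import structures.
From mathcomp Require Import all_boot finmap.

Set Implicit Arguments.
Unset Strict Implicit.
Unset Printing Implicit Defensive.

Local Open Scope fset_scope.

Inductive form (P : Type) : Type :=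
| Var of P
| Top
| Bot
| Neg of form P
| And of form P & form P
| Or of form P & form P
| Imp of form P & form P
| Dia of form P
| Box of form P.

Arguments Top {P}.
Arguments Bot {P}.

(* An encoding into generic trees, used only to make [form P] a choiceType so
   that finite sets of formulas can be formed. *)
Section Encoding.
Variable P : Type.

Fixpoint form_to_tree (f : form P) : GenTree.tree P :=
  match f with
  | Var p => GenTree.Leaf p
  | Top => GenTree.Node 0 [::]
  | Bot => GenTree.Node 1 [::]
  | Neg a => GenTree.Node 2 [:: form_to_tree a]
  | And a b => GenTree.Node 3 [:: form_to_tree a; form_to_tree b]
  | Or a b => GenTree.Node 4 [:: form_to_tree a; form_to_tree b]
  | Imp a b => GenTree.Node 5 [:: form_to_tree a; form_to_tree b]
  | Dia a => GenTree.Node 6 [:: form_to_tree a]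
  | Box a => GenTree.Node 7 [:: form_to_tree a]
  end.

Fixpoint tree_to_form (t : GenTree.tree P) : form P :=
  match t with
  | GenTree.Leaf p => Var p
  | GenTree.Node 0 [::] => Top
  | GenTree.Node 2 [:: a] => Neg (tree_to_form a)
  | GenTree.Node 3 [:: a; b] => And (tree_to_form a) (tree_to_form b)
  | GenTree.Node 4 [:: a; b] => Or (tree_to_form a) (tree_to_form b)
  | GenTree.Node 5 [:: a; b] => Imp (tree_to_form a) (tree_to_form b)
  | GenTree.Node 6 [:: a] => Dia (tree_to_form a)
  | GenTree.Node 7 [:: a] => Box (tree_to_form a)
  | _ => Bot
  end.

Lemma form_to_treeK : cancel form_to_tree tree_to_form.
Proof. by elim=> //= [a ->|a -> b ->|a -> b ->|a -> b ->|a ->|a ->]. Qed.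

End Encoding.

HB.instance Definition _ (P : choiceType) :=
  Choice.copy (form P) (can_type (@form_to_treeK P)).

Record kripke_model (P : Type) : Type := KripkeModel {
  world : Type;
  acc : world -> world -> Prop;
  val : P -> world -> Prop
}.

Fixpoint sat (P : Type) (M : kripke_model P) (w : world M) (f : form P) : Prop :=
  match f with
  | Var p => val p w
  | Top => True
  | Bot => False
  | Neg a => ~ sat w a
  | And a b => sat w a /\ sat w b
  | Or a b => sat w a \/ sat w b
  | Imp a b => sat w a -> sat w b
  | Dia a => exists v : world M, acc w v /\ sat v a
  | Box a => forall v : world M, acc w v -> sat v a
  end.

Definition valid (P : Type) (f : form P) : Prop :=
  forall (M : kripke_model P) (w : world M), sat w f.

(* [nnf_pol true f] is the negation normal form of [f], and [nnf_pol false f]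
   that of [Neg f]. *)
Fixpoint nnf_pol (P : Type) (b : bool) (f : form P) : form P :=
  match f with
  | Var p => if b then Var p else Neg (Var p)
  | Top => if b then Top else Bot
  | Bot => if b then Bot else Top
  | Neg a => nnf_pol (~~ b) a
  | And a c => if b then And (nnf_pol b a) (nnf_pol b c)
               else Or (nnf_pol b a) (nnf_pol b c)
  | Or a c => if b then Or (nnf_pol b a) (nnf_pol b c)
              else And (nnf_pol b a) (nnf_pol b c)
  | Imp a c => if b then Or (nnf_pol (~~ b) a) (nnf_pol b c)
               else And (nnf_pol (~~ b) a) (nnf_pol b c)
  | Dia a => if b then Dia (nnf_pol b a) else Box (nnf_pol b a)
  | Box a => if b then Box (nnf_pol b a) else Dia (nnf_pol b a)
  end.

Definition nnf (P : Type) (f : form P) : form P := nnf_pol true f.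

(* [occurs true p f]: [p] occurs positively in [f];
   [occurs false p f]: [p] occurs negatively in [f]. *)
Fixpoint occurs (P : eqType) (b : bool) (p : P) (f : form P) : bool :=
  match f with
  | Var q => b && (p == q)
  | Top | Bot => false
  | Neg a => occurs (~~ b) p a
  | And a c | Or a c => occurs b p a || occurs b p c
  | Imp a c => occurs (~~ b) p a || occurs b p c
  | Dia a | Box a => occurs b p a
  end.

(* Only used on formulas in negation normal form. The letter [p] does not count
   as a subformula of the literal [Neg (Var p)]. *)
Fixpoint SUBF (P : choiceType) (f : form P) : {fset form P} :=
  match f with
  | Var _ | Top | Bot => [fset f]
  | Neg (Var _) => [fset f]
  | Neg a | Dia a | Box a => f |` SUBF a
  | And a b | Or a b | Imp a b => f |` (SUBF a `|` SUBF b)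
  end.

Definition bigAnd (P : choiceType) (X : {fset form P}) : form P :=
  foldr (@And P) Top (enum_fset X).

Definition locally_consistent (P : choiceType) (X : {fset form P}) : Prop :=
  [/\ forall a b : form P, And a b \in X -> a \in X /\ b \in X,
      forall a b : form P, Or a b \in X -> a \in X \/ b \in X,
      Bot \notin X
    & forall p : P, ~ (Var p \in X /\ Neg (Var p) \in X)].

Variant side : Type := L | R.

Definition type_pair (P : choiceType) : choiceType :=
  ({fset form P} * {fset form P})%type.

Definition component (P : choiceType) (t : type_pair P) (D : side) :
    {fset form P} :=
  match D with L => t.1 | R => t.2 end.

Section TypeElimination.
Variables (P : choiceType) (phi psi : form P).

Definition is_type (t : type_pair P) : Prop :=
  [/\ component t L `<=` SUBF (nnf phi),
      locally_consistent (component t L),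
      component t R `<=` SUBF (nnf (Neg psi))
    & locally_consistent (component t R)].

Definition overlap_consistent (t : type_pair P) : Prop :=
  forall p : P,
    ~ (Var p \in component t L /\ Neg (Var p) \in component t R) /\
    ~ (Neg (Var p) \in component t L /\ Var p \in component t R).

Definition type_step (t t' : type_pair P) : Prop :=
  forall (D : side) (a : form P), Box a \in component t D -> a \in component t' D.

Definition diamonds_witnessed (X : {fset type_pair P}) (t : type_pair P) : Prop :=
  forall (D : side) (a : form P), Dia a \in component t D ->
    exists t' : type_pair P,
      [/\ t' \in X, type_step t t' & a \in component t' D].

Definition quasi_model (X : {fset type_pair P}) : Prop :=
  [/\ forall t, t \in X -> is_type t,
      forall t, t \in X -> overlap_consistent t
    & forall t, t \in X -> diamonds_witnessed X t].

(* The sequence is [X 0, ..., X n]; the values of [X] beyond [n] are irrelevant. *)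
Definition type_elimination_sequence (n : nat) (X : nat -> {fset type_pair P}) :
    Prop :=
  [/\ forall t, t \in X 0 <-> is_type t,
      forall i, i < n -> exists t : type_pair P,
        [/\ t \in X i,
            ~ overlap_consistent t \/ ~ diamonds_witnessed (X i) t
          & X i.+1 = X i `\ t]
    & quasi_model (X n)].

End TypeElimination.

(* Main.v *)
(* Induction along the elimination sequence. A type that is not
   overlap-consistent is separated by the offending literal. If [t] is removed
   because of [Dia a] in its left component, let [A] consist of [a] and of all
   [c] with [Box c] in the left component, and [B] of all [c] with [Box c] in
   the right one. Every type [(x, y)] with [x] containing [A] and [y] containing
   [B] was removed earlier, hence has an interpolant [theta x y]. A world
   satisfying [A] (or [B]) realises a locally consistent set containing it, so
   the disjunction over [x] of the conjunction over [y] of [theta x y] separates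
   [A] from [B], and prefixing it with [Dia] separates [t]. For a diamond in the
   right component, [a] goes into [B] and the prefix is [Box]. *)
Require Import Defs.
From HB Require Import structures.
From mathcomp Require Import all_boot finmap.
From mathcomp Require Import boolp.

Set Implicit Arguments.
Unset Strict Implicit.
Unset Printing Implicit Defensive.

Local Open Scope fset_scope.

(** * Subformulas and polarities of negation normal forms *)

Section Formulas.
Variable P : choiceType.
Implicit Types (f g a b : form P) (A B : {fset form P}).

Lemma sat_bigAnd (M : kripke_model P) (w : world M) A :
  sat w (bigAnd A) <-> (forall a, a \in A -> sat w a).
Proof.
have -> : (forall a, a \in A -> sat w a) <->
          (forall a, a \in enum_fset A -> sat w a) by [].
rewrite /bigAnd; elim: (enum_fset A) => [|c s IHs] /=; first by split.
split=> [[wc /IHs ws] a|ws].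
  by rewrite inE => /predU1P[->|/ws].
split; first by apply: ws; rewrite mem_head.
by apply/IHs => a sa; apply: ws; rewrite inE sa orbT.
Qed.

Lemma SUBF_refl f : f \in SUBF f.
Proof. by case: f => [?|||[]|||||] *; rewrite /= !inE eqxx. Qed.

(** [Neg] gets no immediate subformula: [SUBF] of a literal [Neg (Var p)] omits [Var p], so closure
    would fail there. *)
Definition immediate_subf a f : Prop :=
  match f with
  | And b c | Or b c => a = b \/ a = c
  | Dia b | Box b => a = b
  | _ => False
  end.

Lemma SUBF_immediate f g a : g \in SUBF f -> immediate_subf a g -> a \in SUBF f.
Proof.
have self h : immediate_subf a h -> a \in SUBF h.
  by case: h => //= [b c [] ->|b c [] ->|b ->|b ->]; rewrite !inE SUBF_refl !orbT.
have leaf h : g \in [fset h] -> immediate_subf a g -> immediate_subf a h.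
  by rewrite inE => /eqP ->.
have unary h b : SUBF h = h |` SUBF b -> (g \in SUBF b -> a \in SUBF b) ->
    g \in SUBF h -> immediate_subf a g -> a \in SUBF h.
  move=> E IH; rewrite {1}E in_fset1U => /predU1P[-> /self //|/IH ab _].
  by rewrite E in_fset1U ab orbT.
have binary h b c : SUBF h = h |` (SUBF b `|` SUBF c) ->
    (g \in SUBF b -> a \in SUBF b) -> (g \in SUBF c -> a \in SUBF c) ->
    g \in SUBF h -> immediate_subf a g -> a \in SUBF h.
  move=> E IHb IHc; rewrite {1}E in_fset1U in_fsetU.
  move=> /predU1P[-> /self //|/orP[/IHb|/IHc] aS _].
    by rewrite E in_fset1U in_fsetU aS orbT.
  by rewrite E in_fset1U in_fsetU aS !orbT.
move=> gf ag; elim: f gf => [p|||f IHf|b IHb c IHc|b IHb c IHc|b IHb c IHc|b IHb|b IHb] gf.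
- by case: (leaf _ gf ag).
- by case: (leaf _ gf ag).
- by case: (leaf _ gf ag).
(* [SUBF] treats [Neg (Var _)] as a leaf and any other negation as unary, hence the case split on
   the negated formula. *)
- by case: f IHf gf => [p _ gf|||f|b c|b c|b c|b|b] *;
    [case: (leaf _ gf ag)|..]; apply: unary ag.
- exact: binary ag.
- exact: binary ag.
- exact: binary ag.
- exact: unary ag.
- exact: unary ag.
Qed.

(** The sign of a literal in a negation normal form records the polarity of its letter, reversed
    when [q] is [false]. The induction quantifies over [q] because [Neg] and the antecedent of [Imp]
    flip it. *)
Lemma literal_occurs (q : bool) f (p : P) :
  (Var p \in SUBF (nnf_pol q f) -> occurs q p f) /\
  (Neg (Var p) \in SUBF (nnf_pol q f) -> occurs (~~ q) p f).
Proof.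
have binary l h (x y : {fset form P}) (o1 o2 : bool) : l != h ->
    (l \in x -> o1) -> (l \in y -> o2) -> l \in h |` (x `|` y) -> o1 || o2.
  move=> /negPf lh lx ly; rewrite in_fset1U in_fsetU lh orFb.
  by case/orP=> [/lx ox|/ly oy]; apply/orP; [left|right].
have unary l h (x : {fset form P}) (o : bool) : l != h ->
    (l \in x -> o) -> l \in h |` x -> o.
  by move=> /negPf lh lx; rewrite in_fset1U lh.
elim: f q => [r|||f IHf|b IHb c IHc|b IHb c IHc|b IHb c IHc|b IHb|b IHb] q.
- by case: q; rewrite /= !inE; split=> // /eqP[->]; rewrite eqxx.
- by case: q; rewrite /= !inE.
- by case: q; rewrite /= !inE.
- exact: IHf.
- case: (IHb q) (IHc q) => bV bN [cV cN].
  by case: q bV bN cV cN => /= *; split; apply: binary.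
- case: (IHb q) (IHc q) => bV bN [cV cN].
  by case: q bV bN cV cN => /= *; split; apply: binary.
- case: (IHb (~~ q)) (IHc q) => bV bN [cV cN].
  by case: q bV bN cV cN => /= *; split; apply: binary.
- by case: (IHb q) => bV bN; case: q bV bN => /= *; split; apply: unary.
- by case: (IHb q) => bV bN; case: q bV bN => /= *; split; apply: unary.
Qed.

End Formulas.

Definition interpolant (P : choiceType) (A B : {fset form P}) (theta : form P) :=
  valid (Imp (bigAnd A) theta) /\ valid (Imp theta (Neg (bigAnd B))).

(** * Separating formulas and finite covers *)

Section Separation.
Variables (P : choiceType) (phi psi : form P).
Implicit Types (A B x y : {fset form P}) (theta : form P).

Definition shared theta : Prop :=
  forall (q : bool) p, occurs q p theta -> occurs q p phi /\ occurs q p psi.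

Definition separable A B : Prop :=
  exists theta, interpolant A B theta /\ shared theta.

(** The disjunction of the interpolants for the members of [s] works; for empty [s] it is [Bot]. *)
Lemma separable_coverl (s : seq {fset form P}) A B :
  (forall (M : kripke_model P) (w : world M),
     sat w (bigAnd A) -> exists2 x, x \in s & sat w (bigAnd x)) ->
  (forall x, x \in s -> separable x B) -> separable A B.
Proof.
move=> cover sep.
(* The induction on [s] leaves [A] out, since a tail of [s] need no longer cover [A]. *)
have [theta [sT [Ts Tsh]]] : exists theta,
    (forall x, x \in s -> valid (Imp (bigAnd x) theta)) /\
    valid (Imp theta (Neg (bigAnd B))) /\ shared theta.
  elim: s sep {cover} => [|x s IHs] sep; first by exists Bot; do 2?split=> //; move=> M w [].
  have [|theta [sT [Ts Tsh]]] := IHs.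
    by move=> y ys; apply: sep; rewrite inE ys orbT.
  have [eta [[xE Es] Esh]] := sep x (mem_head _ _).
  exists (Or eta theta); split=> [y|].
    rewrite inE => /predU1P[->|/sT yT] M w wy; first by left; apply: xE.
    by right; apply: yT.
  split=> [M w /= [/Es|/Ts] //|q p /= /orP[/Esh|/Tsh] //].
exists theta; split=> //; split=> // M w /cover[x /sT]; exact.
Qed.

(** Dually, the interpolants are joined by conjunction, starting from [Top]. *)
Lemma separable_coverr (s : seq {fset form P}) A B :
  (forall (M : kripke_model P) (w : world M),
     sat w (bigAnd B) -> exists2 y, y \in s & sat w (bigAnd y)) ->
  (forall y, y \in s -> separable A y) -> separable A B.
Proof.
move=> cover sep.
have [theta [sT [Ts Tsh]]] : exists theta,
    (forall y, y \in s -> valid (Imp theta (Neg (bigAnd y)))) /\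
    valid (Imp (bigAnd A) theta) /\ shared theta.
  elim: s sep {cover} => [|x s IHs] sep; first by exists Top; do 2?split=> //; move=> M w.
  have [|theta [sT [Ts Tsh]]] := IHs.
    by move=> y ys; apply: sep; rewrite inE ys orbT.
  have [eta [[xE Es] Esh]] := sep x (mem_head _ _).
  exists (And eta theta); split=> [y|].
    by rewrite inE => /predU1P[->|/sT yT] M w [we wt]; [apply: Es|apply: yT].
  split=> [M w wA|q p /= /orP[/Esh|/Tsh] //].
  by split; [apply: xE|apply: Ts].
exists theta; split=> //; split=> // M w wt /cover[y /sT yT]; exact: yT.
Qed.

(** * Covers by locally consistent sets *)

Definition consistent_extensions (chi : form P) A : seq {fset form P} :=
  [seq x <- fpowerset (SUBF chi) | (A `<=` x) && `[< locally_consistent x >]].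

Lemma mem_consistent_extensions (chi : form P) A x :
  x \in consistent_extensions chi A ->
  [/\ x `<=` SUBF chi, A `<=` x & locally_consistent x].
Proof.
by rewrite mem_filter fpowersetE => /andP[/andP[Ax /asboolP lx] xchi].
Qed.

Lemma consistent_extensions_cover (chi : form P) A (M : kripke_model P) (w : world M) :
  A `<=` SUBF chi -> sat w (bigAnd A) ->
  exists2 x, x \in consistent_extensions chi A & sat w (bigAnd x).
Proof.
move=> Achi /sat_bigAnd wA.
(* All subformulas true at [w]: local consistency is read off from the truth clauses. *)
pose x := [fset a in SUBF chi | `[< sat w a >]].
have xP a : reflect (a \in SUBF chi /\ sat w a) (a \in x).
  by rewrite !inE; apply: (iffP andP) => -[-> /asboolP].
exists x; last by apply/sat_bigAnd => a /xP[].
rewrite mem_filter fpowersetE; apply/andP; split; last first.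
  by apply/fsubsetP => a /xP[].
apply/andP; split.
  by apply/fsubsetP => a aA; apply/xP; split; [apply: (fsubsetP Achi)|apply: wA].
apply/asboolP; split.
- move=> a b /xP[ab [wa wb]].
  by split; apply/xP; split=> //; apply: SUBF_immediate ab _; [left|right].
- move=> a b /xP[ab [wa|wb]]; [left|right]; apply/xP; split=> //.
    by apply: SUBF_immediate ab _; left.
  by apply: SUBF_immediate ab _; right.
- by apply/xP => -[].
- by move=> p [/xP[_ wp] /xP[_]].
Qed.

Lemma separable_extensions A B :
  A `<=` SUBF (nnf phi) -> B `<=` SUBF (nnf (Neg psi)) ->
  (forall t, is_type phi psi t -> A `<=` component t L -> B `<=` component t R ->
     separable (component t L) (component t R)) ->
  separable A B.
Proof.
move=> Aphi Bpsi sep.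
apply: (@separable_coverl (consistent_extensions (nnf phi) A)).
  by move=> M w; apply: consistent_extensions_cover.
move=> x /mem_consistent_extensions[xphi Ax lx].
apply: (@separable_coverr (consistent_extensions (nnf (Neg psi)) B)).
  by move=> M w; apply: consistent_extensions_cover.
move=> y /mem_consistent_extensions[ypsi By ly].
(* Both components are locally consistent subsets of the right closures, so the pair is itself a
   type. *)
exact: (sep (x, y)).
Qed.

(** * Separation of eliminated types *)

Lemma separable_overlap (t : type_pair P) :
  is_type phi psi t -> ~ overlap_consistent t ->
  separable (component t L) (component t R).
Proof.
move=> [/fsubsetP tphi _ /fsubsetP tpsi _] /existsNP[p /not_andP[|] /contrapT[tL tR]].
- exists (Var p); split; first split.
  + by move=> M w /sat_bigAnd wL; apply: (wL _ tL).
  + by move=> M w wp /sat_bigAnd wR; apply: (wR _ tR).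
  (* [Var p] has only a positive occurrence. It is positive in [psi] because [Neg (Var p)] lies in
     the closure of [nnf (Neg psi)]. *)
  + move=> [] // r /= /eqP ->.
    by split; [apply: (literal_occurs true phi p).1; apply: tphi
              |apply: (literal_occurs false psi p).2; apply: tpsi].
- exists (Neg (Var p)); split; first split.
  + by move=> M w /sat_bigAnd wL; apply: (wL _ tL).
  + by move=> M w wp /sat_bigAnd wR; apply/wp/(wR _ tR).
  + move=> [] // r /= /eqP ->.
    by split; [apply: (literal_occurs true phi p).2; apply: tphi
              |apply: (literal_occurs false psi p).1; apply: tpsi].
Qed.

(** Bounding by [SUBF chi] makes the comprehension finite; nothing is lost when [A] is a subset of
    [SUBF chi]. *)
Definition unbox (chi : form P) A : {fset form P} :=
  [fset a in SUBF chi | Box a \in A].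

Lemma unbox_sub chi A : unbox chi A `<=` SUBF chi.
Proof. by apply/fsubsetP => a; rewrite !inE => /andP[]. Qed.

Lemma mem_unbox chi A a : A `<=` SUBF chi -> Box a \in A -> a \in unbox chi A.
Proof.
move=> /fsubsetP Achi aA; rewrite !inE aA andbT.
exact: SUBF_immediate (Achi _ aA) erefl.
Qed.

Lemma sat_unbox chi A (M : kripke_model P) (w v : world M) :
  sat w (bigAnd A) -> acc w v -> sat v (bigAnd (unbox chi A)).
Proof.
move=> /sat_bigAnd wA wv; apply/sat_bigAnd => a; rewrite !inE => /andP[_ /wA].
exact.
Qed.

Lemma sat_Dia_unbox chi A a (M : kripke_model P) (w : world M) :
  sat w (bigAnd A) -> Dia a \in A ->
  exists v : world M, acc w v /\ sat v (bigAnd (a |` unbox chi A)).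
Proof.
move=> wA aA; have [v [wv va]] := (sat_bigAnd w A).1 wA _ aA.
exists v; split=> //; apply/sat_bigAnd => b; rewrite in_fset1U.
by move=> /predU1P[->//|]; exact: ((sat_bigAnd v _).1 (sat_unbox chi wA wv) b).
Qed.

Lemma separable_diamond (t : type_pair P) D a :
  is_type phi psi t -> Dia a \in component t D ->
  (forall t', is_type phi psi t' -> type_step t t' -> a \in component t' D ->
     separable (component t' L) (component t' R)) ->
  separable (component t L) (component t R).
Proof.
move=> [tphi _ tpsi _] aD sep.
have aSUBF chi A : A `<=` SUBF chi -> Dia a \in A -> a |` unbox chi A `<=` SUBF chi.
  move=> /fsubsetP Achi aA; rewrite fsubUset unbox_sub fsub1set andbT.
  exact: SUBF_immediate (Achi _ aA) erefl.
(* Including both unboxed sets makes [t'] a successor type of [t], so the extensions supplied by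
   [separable_extensions] fall under [sep]. *)
have step (t' : type_pair P) :
    unbox (nnf phi) (component t L) `<=` component t' L ->
    unbox (nnf (Neg psi)) (component t R) `<=` component t' R -> type_step t t'.
  move=> /fsubsetP tL /fsubsetP tR [] b bD; [apply: tL|apply: tR];
  exact: mem_unbox.
case: D aD sep => aD sep.
- have [|||theta [[AT TB] Tsh]] := @separable_extensions
    (a |` unbox (nnf phi) (component t L)) (unbox (nnf (Neg psi)) (component t R)).
  + exact: aSUBF.
  + exact: unbox_sub.
  + move=> t' typ; rewrite fsubUset fsub1set => /andP[at' tL] tR.
    by apply: sep => //; apply: step.
  (* The left component forces a successor satisfying [theta]; the right one makes its unboxed set,
     which refutes [theta], true at every successor. [Dia] keeps polarities. *)
  exists (Dia theta); split=> //; split=> M w.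
    by move=> wL; have [v [wv /AT vT]] := sat_Dia_unbox (nnf phi) wL aD; exists v.
  by move=> [v [wv /TB vB]] wR; apply: vB; apply: sat_unbox wR wv.
- have [|||theta [[AT TB] Tsh]] := @separable_extensions
    (unbox (nnf phi) (component t L)) (a |` unbox (nnf (Neg psi)) (component t R)).
  + exact: unbox_sub.
  + exact: aSUBF.
  + move=> t' typ tL; rewrite fsubUset fsub1set => /andP[at' tR].
    by apply: sep => //; apply: step.
  (* Now every successor satisfies [theta] by the left component, while the right one forces a
     successor refuting it. *)
  exists (Box theta); split=> //; split=> M w.
    by move=> wL v wv; apply/AT/(sat_unbox _ wL wv).
  by move=> wT wR; have [v [/wT /TB]] := sat_Dia_unbox (nnf (Neg psi)) wR aD.
Qed.

Lemma separable_eliminated n (X : nat -> {fset type_pair P}) i t :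
  type_elimination_sequence phi psi n X -> i <= n -> is_type phi psi t ->
  t \notin X i -> separable (component t L) (component t R).
Proof.
move=> [X0 Xstep _]; elim: i t => [|i IHi] t ile tt; first by rewrite (X0 t).2.
(* A type missing from stage [i.+1] is either the one removed now or already missing from stage
   [i]. *)
have [u [_ udef ->]] := Xstep i ile.
rewrite in_fsetD1 negb_and negbK => /orP[/eqP tu|]; last exact: IHi (ltnW ile) tt.
rewrite -{}tu in udef; case: udef => [|bad]; first exact: separable_overlap.
case/existsNP: bad => D /existsNP[a /not_implyP[aD nowit]].
(* A successor type [t'] containing [a] and still present in [X i] would witness the diamond; so
   [t'] is missing from [X i] and the induction hypothesis separates it. *)
apply: (separable_diamond tt aD) => t' tt' stp at'.
by apply: (IHi t' (ltnW ile) tt'); apply/negP => t'X; apply: nowit; exists t'.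
Qed.

End Separation.

Theorem theorem44 (P : choiceType) (phi psi : form P) (n : nat)
    (X : nat -> {fset type_pair P}) :
  valid (Imp phi psi) ->
  type_elimination_sequence phi psi n X ->
  ~ (exists t : type_pair P,
       [/\ t \in X n, nnf phi \in component t L
         & nnf (Neg psi) \in component t R]) ->
  forall t : type_pair P, t \in X 0 `\` X n ->
  exists theta : form P,
    [/\ valid (Imp (bigAnd (component t L)) theta),
        valid (Imp theta (Neg (bigAnd (component t R)))),
        forall p : P, occurs true p theta -> occurs true p phi /\ occurs true p psi
      & forall p : P, occurs false p theta ->
          occurs false p phi /\ occurs false p psi].
Proof.
move=> _ elimX _ t; rewrite in_fsetD => /andP[tXn tX0].
have [X0 _ _] := elimX.
have [theta [[LT TR] sh]] := separable_eliminated elimX (leqnn n) ((X0 t).1 tX0) tXn.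
by exists theta; split=> //; apply: sh.
Qed.
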